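(* Let $-\frac12\le\nu<\frac12$. Then for all $x>0$ and $\tau>0$, $$|K_{\nu+i\tau}(x)|\le\Gamma\left(\frac{\nu+3/2}{2}\right)\Gamma\left(\frac{1/2-\nu}{2}\right)\sqrt{\frac{\tau}{2x\sinh(\pi\tau)}} .$$
   Context: $K_z(x)=\int_0^\infty e^{-x\cosh t}\cosh(zt)\,dt$ ($x>0$, $z\in\mathbb{C}$) is the Macdonald function (modified Bessel function of the second kind); $\Gamma$ is the Euler gamma function. *)

(* Defs.v *)
From mathcomp Require Export all_boot all_order all_algebra.
From mathcomp Require Export all_classical all_reals all_analysis.
From mathcomp Require Export complex.

Set Implicit Arguments.
Unset Strict Implicit.
Unset Printing Implicit Defensive.

Import Order.TTheory GRing.Theory Num.Theory.
Import numFieldNormedType.Exports.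

Local Open Scope classical_set_scope.
Local Open Scope ring_scope.
Local Open Scope complex_scope.

Definition cosh {R : realType} (t : R) : R := (expR t + expR (- t)) / 2.

Definition sinh {R : realType} (t : R) : R := (expR t - expR (- t)) / 2.

Definition expC {R : realType} (z : R[i]) : R[i] :=
  (expR (complex.Re z))%:C * (cos (complex.Im z) +i* sin (complex.Im z)).

Definition coshC {R : realType} (z : R[i]) : R[i] :=
  (expC z + expC (- z)) / 2.

(* Lebesgue integral of a complex-valued function, taken componentwise. As for
   Rintegral, it is meaningful only when both components are integrable. *)
Definition Cintegral {R : realType} (D : set R) (f : R -> R[i]) : R[i] :=
  (\int[lebesgue_measure]_(t in D) complex.Re (f t))
  +i* (\int[lebesgue_measure]_(t in D) complex.Im (f t)).

(* Macdonald function K_z(x); the integrand is integrable for all x > 0. *)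
Definition macdonald {R : realType} (z : R[i]) (x : R) : R[i] :=
  Cintegral `[0, +oo[ (fun t => (expR (- x * cosh t))%:C * coshC (z * t%:C)).

(* Euler's integral, hence the gamma function only for s > 0. *)
Definition Gamma {R : realType} (s : R) : R :=
  \int[lebesgue_measure]_(t in `]0, +oo[) (t `^ (s - 1) * expR (- t)).

(* Main.v *)
Require Import Defs.
From mathcomp Require Import ring lra measurable_realfun.

Set Implicit Arguments.
Unset Strict Implicit.
Unset Printing Implicit Defensive.

Import Order.TTheory GRing.Theory Num.Theory.
Import numFieldNormedType.Exports.

Local Open Scope classical_set_scope.
Local Open Scope ring_scope.
Local Open Scope complex_scope.

(* Write K_z(x) = 1/2 int_R exp(-x cosh t + z t) dt with z = nu + i tau. Moving
   the line of integration to t + i th, 0 <= th < pi/2, and using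
   cosh (nu t) <= cosh (t/2) gives
     |K_z(x)| <= exp(-tau th) int_0^oo exp(-x cos th cosh t) cosh(t/2) dt
              <= exp(-tau th) sqrt(pi / (2 x cos th)),
   the last integral being Gaussian in the variable sinh(t/2). For the optimal
   angle th = atan(2 tau), the elementary inequality
     exp(-2 tau th) sqrt(1 + 4 tau^2) sinh(pi tau) <= pi tau
   turns this into |K_z(x)| <= pi sqrt(tau / (2 x sinh(pi tau))). The two Gamma
   factors have arguments a and 1 - a, so by log-convexity their product is at
   least Gamma(1/2)^2 = pi. *)

(** * Differentiation rules for explicit real functions *)

Section derivation_rules.
Context {R : realType}.
Implicit Types (f g : R -> R) (x a b k : R).

(** The angle atan (2 tau) minimises exp(-tau th) / sqrt (cos th), whose logarithmic derivative is
    -tau + tan th / 2. The quotient of the two sides of the resulting inequality in tau tends to 1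
    at tau = 0 and to e / pi at infinity. The range is therefore cut at s = 2 tau = 1: Taylor bounds
    serve below, a monotonicity argument above. The tight spot is 2 exp(pi / 2) <= pi^2 at the cut,
    which calls for explicit rational bounds on pi. The contour is moved without Cauchy's theorem:
    the th-derivative of the integrand is the t-derivative of a decaying function, so the integral
    along the shifted line has derivative zero in th. Domination comes from the double exponential
    decay of exp(-x cos th cosh t), which is uniform only while cos th stays away from 0. *)

Lemma is_derive_const k x : is_derive x 1 (fun _ : R => k) 0.
Proof. exact: is_derive_cst. Qed.

Lemma is_derive_var x : is_derive x 1 (fun t : R => t) 1.
Proof. exact: is_derive_id. Qed.

Lemma is_derive_add f g x a b : is_derive x 1 f a -> is_derive x 1 g b ->
  is_derive x 1 (fun t => f t + g t) (a + b).
Proof. by move=> df dg; exact: is_deriveD. Qed.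

Lemma is_derive_opp f x a : is_derive x 1 f a ->
  is_derive x 1 (fun t => - f t) (- a).
Proof. by move=> df; exact: is_deriveN. Qed.

Lemma is_derive_mul f g x a b : is_derive x 1 f a -> is_derive x 1 g b ->
  is_derive x 1 (fun t => f t * g t) (a * g x + f x * b).
Proof.
move=> df dg; apply: (is_derive_eq (is_deriveM df dg)).
by rewrite /GRing.scale/= addrC mulrC.
Qed.

Lemma is_derive_pow f n x a : is_derive x 1 f a ->
  is_derive x 1 (fun t => f t ^+ n) (n%:R * f x ^+ n.-1 * a).
Proof.
move=> df; rewrite (_ : (fun t => _) = f ^+ n); last first.
  by apply/funext => t; rewrite exprfctE.
exact: is_deriveX.
Qed.

Lemma is_derive_exp f x a : is_derive x 1 f a ->
  is_derive x 1 (fun t => expR (f t)) (expR (f x) * a).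
Proof. by move=> df; exact: (@is_derive1_comp _ expR f). Qed.

Lemma is_derive_sin_comp f x a : is_derive x 1 f a ->
  is_derive x 1 (fun t => sin (f t)) (cos (f x) * a).
Proof. by move=> df; exact: (@is_derive1_comp _ sin f). Qed.

Lemma is_derive_cos_comp f x a : is_derive x 1 f a ->
  is_derive x 1 (fun t => cos (f t)) (- sin (f x) * a).
Proof. by move=> df; exact: (@is_derive1_comp _ cos f). Qed.

Lemma is_derive_atan_comp f x a : is_derive x 1 f a ->
  is_derive x 1 (fun t => atan (f t)) ((1 + f x ^+ 2)^-1 * a).
Proof. by move=> df; exact: (@is_derive1_comp _ atan f). Qed.

Lemma is_derive_ln_comp f x a : 0 < f x -> is_derive x 1 f a ->
  is_derive x 1 (fun t => ln (f t)) ((f x)^-1 * a).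
Proof.
move=> fx0 df; apply: (@is_derive1_comp _ (@ln R) f) => //.
exact: is_derive1_ln.
Qed.

Lemma is_derive_comp_opp f x a : is_derive (- x) 1 f a ->
  is_derive x 1 (fun t => f (- t)) (- a).
Proof.
move=> df; have dN : is_derive x 1 (fun t : R => - t) (- 1).
  exact: is_derive_opp (is_derive_var x).
by have := @is_derive1_comp _ f (fun t => - t) x a (- 1) df dN; rewrite mulrN1.
Qed.

Lemma is_derive_cosh f x a : is_derive x 1 f a ->
  is_derive x 1 (fun t => cosh (f t)) (sinh (f x) * a).
Proof.
move=> df; have dN := is_derive_exp (is_derive_opp df).
apply: (is_derive_eq (is_derive_mul (is_derive_add (is_derive_exp df) dN)
  (is_derive_const 2^-1 x))).
by rewrite /sinh; ring.
Qed.

Lemma is_derive_sinh f x a : is_derive x 1 f a ->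
  is_derive x 1 (fun t => sinh (f t)) (cosh (f x) * a).
Proof.
move=> df; have dN := is_derive_opp (is_derive_exp (is_derive_opp df)).
apply: (is_derive_eq (is_derive_mul (is_derive_add (is_derive_exp df) dN)
  (is_derive_const 2^-1 x))).
by rewrite /cosh; ring.
Qed.

Lemma is_derive_continuous_at f x a :
  is_derive x 1 f a -> {for x, continuous f}.
Proof.
move=> df; apply: differentiable_continuous.
by apply/derivable1_diffP; exact: ex_derive.
Qed.

Lemma is_derive_continuous f (df : R -> R) :
  (forall x, is_derive x 1 f (df x)) -> continuous f.
Proof. by move=> dfE x; exact: is_derive_continuous_at (dfE x). Qed.

(** Mean value theorem. Besides the elementary inequalities it serves, with [df] zero, to compare
    the integrals at two heights of the contour. *)
Lemma le_of_derive f (df : R -> R) a b : a <= b ->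
  (forall x, a <= x <= b -> is_derive x 1 f (df x)) ->
  (forall x, a <= x <= b -> 0 <= df x) -> f a <= f b.
Proof.
move=> ab dfE df0.
have [||c] := @MVT_segment R f df a b ab.
- by move=> x; rewrite in_itv/= => /andP[ax xb]; apply: dfE; rewrite !ltW.
- apply: continuous_in_subspaceT => x; rewrite inE/= in_itv/= => xab.
  exact: is_derive_continuous_at (dfE _ xab).
rewrite in_itv/= => cab fE; rewrite -subr_ge0 fE mulr_ge0 ?df0// subr_ge0//.
Qed.

End derivation_rules.

(* [is_derive] is a class: [notypeclasses refine] keeps instance resolution from
   solving the premises with derivatives in another form. The last rules undo
   the eta-reductions performed by unification. *)
Ltac derive_step :=
  lazymatch goal with
  | |- is_derive _ _ (fun _ => ?c) _ => exact: is_derive_const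
  | |- is_derive _ _ (fun _ => _ + _) _ => notypeclasses refine (is_derive_add _ _)
  | |- is_derive _ _ (fun _ => - _) _ => notypeclasses refine (is_derive_opp _)
  | |- is_derive _ _ (fun _ => _ * _) _ => notypeclasses refine (is_derive_mul _ _)
  | |- is_derive _ _ (fun _ => _ ^+ _) _ => notypeclasses refine (is_derive_pow _ _)
  | |- is_derive _ _ (fun _ => expR _) _ => notypeclasses refine (is_derive_exp _)
  | |- is_derive _ _ (fun _ => sin _) _ => notypeclasses refine (is_derive_sin_comp _)
  | |- is_derive _ _ (fun _ => cos _) _ => notypeclasses refine (is_derive_cos_comp _)
  | |- is_derive _ _ (fun _ => sinh _) _ => notypeclasses refine (is_derive_sinh _)
  | |- is_derive _ _ (fun _ => cosh _) _ => notypeclasses refine (is_derive_cosh _)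
  | |- is_derive _ _ (fun _ => atan _) _ => notypeclasses refine (is_derive_atan_comp _)
  | |- is_derive _ _ (fun _ => ln _) _ => notypeclasses refine (is_derive_ln_comp _ _)
  | |- is_derive _ _ (fun t => t) _ => exact: is_derive_var
  | |- is_derive _ _ (@expR _) _ => notypeclasses refine (is_derive_expR _)
  | |- is_derive _ _ (@sin _) _ => notypeclasses refine (is_derive_sin _)
  | |- is_derive _ _ (@cos _) _ => notypeclasses refine (is_derive_cos _)
  | |- is_derive _ _ (@atan _) _ => notypeclasses refine (is_derive1_atan _)
  | |- is_derive _ _ (@ln _) _ => notypeclasses refine (is_derive1_ln _)
  | |- is_derive ?x ?v (@GRing.opp ?T) ?d => change (is_derive x v (fun t => - t) d)
  | |- is_derive ?x ?v (@GRing.add ?T ?c) ?d => change (is_derive x v (fun t => c + t) d)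
  | |- is_derive ?x ?v (@GRing.mul ?T ?c) ?d => change (is_derive x v (fun t => c * t) d)
  | |- is_derive ?x ?v (@sinh ?T) ?d => change (is_derive x v (fun t : T => sinh t) d)
  | |- is_derive ?x ?v (@cosh ?T) ?d => change (is_derive x v (fun t : T => cosh t) d)
  | |- _ => eassumption
  end.

Ltac derive :=
  notypeclasses refine (is_derive_eq _ _);
  [ solve [repeat derive_step] | cbn beta iota delta [Nat.pred] ].

(** * Hyperbolic functions *)

Section hyperbolic.
Context {R : realType}.
Implicit Types t : R.

Lemma cosh_ge0 t : 0 <= cosh t.
Proof. by rewrite divr_ge0// addr_ge0 ?expR_ge0. Qed.

Lemma ltr_sinh t1 t2 : t1 < t2 -> sinh t1 < sinh t2.
Proof.
move=> t12; rewrite /sinh ltr_pM2r ?invr_gt0// ltrB//.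
  by rewrite ltr_expR.
by rewrite ltr_expR ltrN2.
Qed.

Lemma cosh_half t : cosh t = 1 + 2 * sinh (t / 2) ^+ 2.
Proof.
rewrite /cosh /sinh.
have -> : t = t / 2 + t / 2 by field.
rewrite (_ : (t / 2 + t / 2) / 2 = t / 2); last by field.
rewrite opprD !expRD.
have : expR (t / 2) * expR (- (t / 2)) = 1 by rewrite expRxMexpNx_1.
move: (expR (t / 2)) (expR (- (t / 2))) => a b ab.
transitivity (a * b + 2 * ((a - b) / 2) ^+ 2); first by field.
by rewrite ab.
Qed.

Lemma coshN t : cosh (- t) = cosh t :> R.
Proof. by rewrite /cosh opprK addrC. Qed.

Lemma norm_sinh_le_cosh t : `|sinh t| <= cosh t.
Proof.
by rewrite ler_norml /sinh /cosh; have := expR_ge0 t; have := expR_ge0 (- t);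
  move=> *; apply/andP; split; lra.
Qed.

Lemma cosh_le_expR t : 0 <= t -> cosh t <= expR t.
Proof.
move=> t0; have : expR (- t) <= expR t by rewrite ler_expR; lra.
by rewrite /cosh; lra.
Qed.

Lemma cosh_ge_expR_half t : expR t / 2 <= cosh t.
Proof. by rewrite /cosh; have := expR_ge0 (- t); lra. Qed.

End hyperbolic.

(** * Elementary inequalities: bounds on pi and the estimate at the optimal angle *)

Section real_inequalities.
Context {R : realType}.
Implicit Types s u v x z : R.

Lemma onesqr_neq0 x : 1 + x ^+ 2 != 0.
Proof. by rewrite gt_eqF// ltr_wpDr// sqr_ge0. Qed.

(** The derivative 1 / (1 + s^2) differs from its truncated geometric series by a single fraction of
    constant sign; the same holds for the next two bounds. *)
Lemma atan_ge_cubic s : 0 <= s -> s - s ^+ 3 / 3 <= atan s.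
Proof.
move=> s0; rewrite -subr_ge0.
have -> : 0 = atan 0 - (0 - 0 ^+ 3 / 3) :> R by rewrite atan0; ring.
apply: (@le_of_derive _ (fun s => atan s - (s - s ^+ 3 / 3))
  (fun s => s ^+ 4 / (1 + s ^+ 2))) => // x _.
  by derive; field; rewrite onesqr_neq0.
by rewrite divr_ge0// ?addr_ge0 ?sqr_ge0// (exprM _ 2 2) sqr_ge0.
Qed.

Lemma atan_le_quintic s : 0 <= s -> atan s <= s - s ^+ 3 / 3 + s ^+ 5 / 5.
Proof.
move=> s0; rewrite -subr_ge0.
have -> : 0 = (0 - 0 ^+ 3 / 3 + 0 ^+ 5 / 5) - atan 0 :> R by rewrite atan0; ring.
apply: (@le_of_derive _ (fun s => (s - s ^+ 3 / 3 + s ^+ 5 / 5) - atan s)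
  (fun s => s ^+ 6 / (1 + s ^+ 2))) => // x _.
  by derive; field; rewrite onesqr_neq0.
by rewrite divr_ge0// ?addr_ge0 ?sqr_ge0// (exprM _ 3 2) sqr_ge0.
Qed.

Lemma atan_le_id s : 0 <= s -> atan s <= s.
Proof.
move=> s0; rewrite -subr_ge0.
have -> : 0 = 0 - atan 0 :> R by rewrite atan0; ring.
apply: (@le_of_derive _ (fun s => s - atan s)
  (fun s => s ^+ 2 / (1 + s ^+ 2))) => // x _.
  by derive; field; rewrite onesqr_neq0.
by rewrite divr_ge0// ?addr_ge0 ?sqr_ge0.
Qed.

Lemma cos_atan_gt0 s : 0 < cos (atan s).
Proof. by rewrite cos_gt0_pihalf// atan_gtNpi2 atan_ltpi2. Qed.

(** Both sides have tangent 1. The crude bounds place the sum in [0, 5/6], hence below pi / 2, where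
    tan is injective. *)
Lemma piquarter_machin : pi / 4 = atan (1 / 2) + atan (1 / 3) :> R.
Proof.
have a2 : atan (1 / 2) <= 1 / 2 :> R by apply: atan_le_id; lra.
have a3 : atan (1 / 3) <= 1 / 3 :> R by apply: atan_le_id; lra.
have b2 : 0 <= atan (1 / 2) :> R by rewrite -atan0; apply: le_atan; lra.
have b3 : 0 <= atan (1 / 3) :> R by rewrite -atan0; apply: le_atan; lra.
have p2 := @pi_ge2 R.
apply: tan_inj.
- by rewrite in_itv/=; apply/andP; split; lra.
- by rewrite in_itv/=; apply/andP; split; lra.
rewrite tan_piquarter tanD ?gt_eqF ?cos_atan_gt0// !atanK.
by field.
Qed.

(* The accuracy is dictated by [expR_pihalf_le], where the two sides differ by
   less than 3%. *)
Lemma pi_bounds : 240 / 77 <= (pi : R) <= 107 / 34.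
Proof.
have := piquarter_machin.
have := @atan_ge_cubic (1 / 2) ltac:(lra).
have := @atan_ge_cubic (1 / 3) ltac:(lra).
have := @atan_le_quintic (1 / 2) ltac:(lra).
have := @atan_le_quintic (1 / 3) ltac:(lra).
by move=> *; lra.
Qed.

Lemma expR_le_pade z : 0 <= z -> (2 - z) * expR z <= 2 + z.
Proof.
move=> z0; rewrite -subr_ge0.
have -> : 0 = 2 + 0 - (2 - 0) * expR 0 :> R by rewrite expR0; ring.
apply: (@le_of_derive _ (fun z => 2 + z - (2 - z) * expR z)
  (fun z => 1 - (1 - z) * expR z)) => // x _.
  by derive; ring.
have := expR_ge1Dx (- x); rewrite expRN => h.
rewrite subr_ge0 -(@ler_pM2r _ (expR x)^-1) ?invr_gt0 ?expR_gt0//.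
by rewrite mul1r mulfK// gt_eqF// expR_gt0.
Qed.

Lemma expR_pihalf_le : 2 * expR (pi / 2) <= pi ^+ 2 :> R.
Proof.
have /andP[p1 p2] := pi_bounds.
(* The Padé bound is too coarse at pi / 2, so the argument is divided by 8. The value 67 / 55 lies
   just above (2 + z) / (2 - z) at z = 107 / 544, the upper bound for pi / 16. *)
have h : expR (pi / 16) <= 67 / 55 :> R.
  have := @expR_le_pade (pi / 16) ltac:(lra); have := expR_gt0 (pi / 16 : R).
  nra.
have -> : pi / 2 = 8%:R * (pi / 16) :> R by field.
rewrite expRM_natl.
have h0 := expR_ge0 (pi / 16 : R).
have : expR (pi / 16) ^+ 8 <= (67 / 55) ^+ 8 :> R.
  by rewrite lerXn2r ?nnegrE//; lra.
nra.
Qed.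

(** The constant 6 matches the Taylor expansion sinh u = u + u^3 / 6 + ... . A cascade of
    derivatives proves it: each of [h1], [h2], [h3] controls the sign of the derivative in the next
    one, starting from sinh <= cosh. *)
Lemma sinh_le_gauss u : 0 <= u -> u <= 2 -> expR (- (u ^+ 2 / 6)) * sinh u <= u.
Proof.
have cosh0 : cosh 0 = 1 :> R by rewrite /cosh oppr0 expR0; lra.
have sinh0 : sinh 0 = 0 :> R by rewrite /sinh oppr0 expR0; lra.
have sinh_ge0 z : 0 <= z -> 0 <= sinh z.
  by move=> z0; rewrite /sinh divr_ge0// subr_ge0 ler_expR; lra.
have sinh_le_cosh z : sinh z <= cosh z.
  by rewrite /sinh /cosh; have := expR_ge0 (- z); lra.
have h1 z : 0 <= z -> z <= 2 -> 0 <= 4 * sinh z - z * cosh z.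
  move=> z0 z2; have -> : 0 = 4 * sinh 0 - 0 * cosh 0 :> R by rewrite sinh0; ring.
  apply: (@le_of_derive _ (fun z => 4 * sinh z - z * cosh z)
    (fun z => 3 * cosh z - z * sinh z)) => // x /andP[x0 xz].
    by derive; ring.
  have := sinh_ge0 _ x0; have := sinh_le_cosh x; nra.
have h2 z : 0 <= z -> z <= 2 -> 0 <= 6 * z * cosh z - (6 + z ^+ 2) * sinh z.
  move=> z0 z2; have -> : 0 = 6 * 0 * cosh 0 - (6 + 0 ^+ 2) * sinh 0 :> R.
    by rewrite sinh0; ring.
  apply: (@le_of_derive _ (fun z => 6 * z * cosh z - (6 + z ^+ 2) * sinh z)
    (fun z => z * (4 * sinh z - z * cosh z))) => // x /andP[x0 xz].
    by derive; ring.
  by rewrite mulr_ge0// h1//; lra.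
pose e z := expR (- (z ^+ 2 / 6)).
have h3 z : 0 <= z -> z <= 2 -> 0 <= 1 - e z * (cosh z - z / 3 * sinh z).
  move=> z0 z2; have -> : 0 = 1 - e 0 * (cosh 0 - 0 / 3 * sinh 0) :> R.
    by rewrite /e expr0n/= mul0r oppr0 expR0 cosh0; ring.
  apply: (@le_of_derive _ (fun z => 1 - e z * (cosh z - z / 3 * sinh z))
    (fun z => e z / 9 * (6 * z * cosh z - (6 + z ^+ 2) * sinh z)))
      => // x /andP[x0 xz].
    by rewrite /e; derive; field.
  by rewrite mulr_ge0 ?h2//; [rewrite divr_ge0// expR_ge0 | lra].
move=> u0 u2; rewrite -subr_ge0 -/(e u).
have -> : 0 = 0 - e 0 * sinh 0 :> R by rewrite sinh0; ring.
apply: (@le_of_derive _ (fun u => u - e u * sinh u)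
  (fun z => 1 - e z * (cosh z - z / 3 * sinh z))) => // x /andP[x0 xz].
  by rewrite /e; derive; field.
by apply: h3 => //; lra.
Qed.

(* For th = atan s and tau = s / 2, the square of expR (- tau * th) / sqrt (cos th)
   is expR (shift_gain s). *)
Definition shift_gain s := ln (1 + s ^+ 2) / 2 - s * atan s.

(** [shift_gain s] is the minimum over th of - s th - ln (cos th), attained at th = atan s, so its
    derivative is minus the minimiser. *)
Lemma is_derive_shift_gain s : is_derive s 1 shift_gain (- atan s).
Proof.
have s1 : 0 < 1 + s ^+ 2 by rewrite ltr_wpDr// sqr_ge0.
by rewrite /shift_gain; derive; field; rewrite onesqr_neq0.
Qed.

(* Here shift_gain s <= - s^2 / 2 + s^4 / 12, and pi^2 <= 10. *)
Lemma shift_gain_small s : 0 <= s -> s <= 1 ->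
  expR (shift_gain s) * sinh (pi / 2 * s) <= pi / 2 * s.
Proof.
move=> s0 s1.
have /andP[p1 p2] := pi_bounds.
have q : shift_gain s <= - s ^+ 2 / 2 + s ^+ 4 / 12.
  rewrite -subr_ge0.
  have -> : 0 = (- 0 ^+ 2 / 2 + 0 ^+ 4 / 12) - shift_gain 0 :> R.
    by rewrite /shift_gain expr0n/= addr0 ln1 expr0n/=; ring.
  apply: (@le_of_derive _ (fun s => (- s ^+ 2 / 2 + s ^+ 4 / 12) - shift_gain s)
    (fun s => atan s - (s - s ^+ 3 / 3)) 0 s s0); move=> x /andP[x0 xs].
    have dx := is_derive_shift_gain x.
    by derive; field.
  by rewrite subr_ge0 atan_ge_cubic.
have u0 : 0 <= pi / 2 * s by nra.
apply: le_trans (sinh_le_gauss u0 _); last by nra.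
apply: ler_wpM2r; first by rewrite /sinh divr_ge0// subr_ge0 ler_expR; lra.
rewrite ler_expR; apply: (le_trans q).
rewrite exprMn.
(* With w = s^2 it remains to see that w^2 / 12 <= w (1/2 - pi^2 / 24). By pi^2 <= 10 the bracket is
   at least 1/12, so w <= 1 is exactly what is used. *)
have pp : pi ^+ 2 <= 10 :> R by nra.
have ss : s ^+ 2 <= 1 by nra.
have ss0 := sqr_ge0 s.
have : s ^+ 4 = (s ^+ 2) ^+ 2 by ring.
move: (s ^+ 2) ss ss0 => w ? ? ->.
rewrite exprMn exprVn; nra.
Qed.

Lemma pihalf_sub_atan_le s : 0 < s -> pi / 2 - atan s <= s^-1.
Proof.
move=> s0.
have a0 : 0 < atan s by rewrite -[ltLHS]atan0; exact: lt_atan.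
have a1 := atan_ltpi2 s.
have p := @pi_gt0 R.
have <- : atan (s^-1) = pi / 2 - atan s.
  apply: tan_inj; rewrite ?in_itv/=.
  - by rewrite atan_gtNpi2 atan_ltpi2.
  - by apply/andP; split; lra.
  rewrite atanK -{1}(atanK s) /tan invf_div sinB cosB sin_pihalf cos_pihalf.
  by congr (_ / _); ring.
by apply: atan_le_id; rewrite invr_ge0 ltW.
Qed.

(* On [1, +oo[, shift_gain s + pi s / 2 - ln s is decreasing, and at s = 1 it is at
   most ln pi by [expR_pihalf_le]. *)
Lemma shift_gain_large s : 1 <= s ->
  expR (shift_gain s) * sinh (pi / 2 * s) <= pi / 2 * s.
Proof.
move=> s1; have s0 : 0 < s by lra.
pose L x := - (shift_gain x + pi / 2 * x - ln x).
have : L 1 <= L s.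
  apply: (@le_of_derive _ L (fun x => x^-1 - (pi / 2 - atan x))) => // x /andP[x1 xs].
    have dx := is_derive_shift_gain x; have x0 : 0 < x by lra.
    by rewrite /L; derive; ring.
  by rewrite subr_ge0 pihalf_sub_atan_le//; lra.
rewrite lerN2 => Ls.
have L1 : shift_gain 1 + pi / 2 * 1 - ln 1 <= ln pi :> R.
  have := expR_pihalf_le.
  rewrite -ler_ln ?posrE ?mulr_gt0 ?expR_gt0 ?exprn_gt0 ?pi_gt0//.
  rewrite lnM ?posrE ?expR_gt0// expRK lnXn ?pi_gt0// /shift_gain atan1 ln1 expr1n.
  by rewrite -[1 + 1]/(2 : R) -mulr_natl; lra.
have {Ls}L1 : shift_gain s + pi / 2 * s <= ln (pi * s).
  by rewrite lnM ?posrE ?pi_gt0//; lra.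
(* In this range sinh u <= exp(u) / 2 is accurate enough. *)
have h : expR (shift_gain s) * expR (pi / 2 * s) <= pi * s.
  by rewrite -expRD -[leRHS]lnK ?posrE ?mulr_gt0 ?pi_gt0// ler_expR.
rewrite /sinh; have := expR_ge0 (- (pi / 2 * s)); have := expR_ge0 (shift_gain s).
nra.
Qed.

Lemma shift_gain_le s : 0 <= s ->
  expR (shift_gain s) * sinh (pi / 2 * s) <= pi / 2 * s.
Proof.
by move=> s0; case: (leP 1 s) => [|/ltW] hs;
  [exact: shift_gain_large | exact: shift_gain_small].
Qed.

End real_inequalities.

(** * Gamma integrals and the bound Gamma(a) Gamma(1 - a) >= pi *)

Section gamma.
Context {R : realType}.
Notation mu := (@lebesgue_measure R).
Implicit Types (a t u : R).

(** Compact intervals away from the singularity of t^(a - 1) at 0, on which the fundamental theorem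
    of calculus and substitution apply. *)
Definition exhaust (n : nat) : set R := `[n.+1%:R^-1, n.+1%:R].

Lemma exhaust_gt0 n t : exhaust n t -> 0 < t.
Proof.
rewrite /exhaust/= in_itv/= => /andP[h _]; apply: lt_le_trans h.
by rewrite invr_gt0.
Qed.

Lemma ge0_integral_oy_le (f : R -> R) (M : \bar R) :
  measurable_fun (`]0, +oo[ : set R) f -> (forall t, 0 < t -> 0 <= f t) ->
  (forall n, (\int[mu]_(x in exhaust n) (f x)%:E <= M)%E) ->
  (\int[mu]_(x in `]0%R, +oo[) (f x)%:E <= M)%E.
Proof.
move=> mf f0 fM.
have cover : \bigcup_n exhaust n = `]0, +oo[%classic.
  apply/seteqP; split => t.
    by move=> [n _ /exhaust_gt0 t0]; rewrite /= in_itv/= andbT.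
  rewrite /= in_itv/= andbT => t0.
  have tn := truncnS_gt t; have tVn := truncnS_gt t^-1.
  have tV0 : 0 < t^-1 by rewrite invr_gt0.
  exists (maxn (Num.truncn t) (Num.truncn t^-1)) => //.
  rewrite /exhaust/= in_itv/=; apply/andP; split.
    rewrite -[leRHS]invrK lef_pV2 ?posrE// (le_trans (ltW tVn))//.
    by rewrite ler_nat ltnS leq_maxr.
  by rewrite (le_trans (ltW tn))// ler_nat ltnS leq_maxl.
rewrite -cover.
have nd : nondecreasing_seq exhaust.
  move=> m n mn; rewrite subsetEset => t; rewrite /exhaust/= !in_itv/= => /andP[h1 h2].
  apply/andP; split.
    by rewrite (le_trans _ h1)// lef_pV2 ?posrE// ler_nat.
  by rewrite (le_trans h2)// ler_nat.
have mE n : measurable (exhaust n) by exact: measurable_itv.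
have sub n : exhaust n `<=` (`]0, +oo[ : set R).
  by move=> t /exhaust_gt0 t0; rewrite /= in_itv/= andbT.
have mfE n : measurable_fun (exhaust n) (EFin \o f).
  by apply/measurable_EFinP; exact: measurable_funS (sub n) mf.
have h := @ge0_nondecreasing_set_cvg_integral _ (measurableTypeR R) R exhaust
  (EFin \o f) mu nd mE mfE (fun n t nt => f0 t (exhaust_gt0 nt)).
rewrite -(cvg_lim _ h)//; apply: lime_le; first exact: cvgP h.
by apply: nearW => n; exact: fM.
Qed.

Definition gamma_kernel a t := t `^ (a - 1) * expR (- t).

Lemma gamma_kernel_ge0 a t : 0 <= gamma_kernel a t.
Proof. by rewrite mulr_ge0 ?powR_ge0 ?expR_ge0. Qed.

Lemma measurable_gamma_kernel a (D : set R) : measurable_fun D (gamma_kernel a).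
Proof.
apply: measurable_funTS; apply: measurable_funM; first exact: measurable_powR.
by apply: measurableT_comp => //; exact: measurable_oppr.
Qed.

Lemma powR_le_add1 a t : 0 < a <= 1 -> 0 < t -> t `^ a <= 1 + t.
Proof.
move=> /andP[a0 a1] t0; have [t1|t1] := leP t 1.
  have : t `^ a <= t `^ 0 by apply: ger_powR; rewrite ?t0// ltW.
  by rewrite powRr0; lra.
by have := @ler1_powR _ t a (ltW t1) a1; lra.
Qed.

Lemma integrable_gamma_kernel a : 0 < a <= 1 ->
  mu.-integrable (`]0, +oo[ : set R) (EFin \o gamma_kernel a).
Proof.
move=> a01; have /andP[a0 a1] := a01.
apply/integrableP; split; first by apply/measurable_EFinP; exact: measurable_gamma_kernel.
under eq_integral do rewrite /= ger0_norm ?gamma_kernel_ge0//.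
apply: (@le_lt_trans _ _ (3 / a)%:E); last exact: ltry.
apply: ge0_integral_oy_le => [|t _|n].
- exact: measurable_gamma_kernel.
- exact: gamma_kernel_ge0.
(* Integration by parts suggests t^a exp(-t) / a, whose derivative falls short of the kernel by t^a
   exp(-t) / a. Since t^a <= 1 + t, the derivative (1 + t) exp(-t) of -(2 + t) exp(-t) makes up for
   it. At the right end F <= 0, and at a left end c <= 1, -F(c) <= (2 + c) / a <= 3 / a. *)
pose F t := (t `^ a * expR (- t) - (2 + t) * expR (- t)) / a.
pose f t := (a * t `^ (a - 1) * expR (- t) - t `^ a * expR (- t)
  + (1 + t) * expR (- t)) / a.
have dF t : 0 < t -> is_derive t 1 F (f t).
  by move=> t0; have da := @is_derive1_powR R a t t0; rewrite /F /f; derive; ring.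
have cf t : 0 < t -> {for t, continuous f}.
  move=> t0; have da := @is_derive1_powR R a t t0.
  have da1 := @is_derive1_powR R (a - 1) t t0.
  by rewrite /f; apply: is_derive_continuous_at; derive; reflexivity.
have FTC (c b : R) : 0 < c -> c <= b ->
    (\int[mu]_(t in `[c, b]) (f t)%:E <= (F b - F c)%:E)%E.
  rewrite le_eqVlt => c0 /predU1P[->|cb].
    by rewrite set_itv1 integral_set1 subrr.
  rewrite (@continuous_FTC2 _ f F c b cb) ?EFinB//.
  - apply: continuous_in_subspaceT => t; rewrite inE/= in_itv/= => /andP[ct _].
    by apply: cf; exact: lt_le_trans ct.
  - split => [t||].
    + rewrite in_itv/= => /andP[ct _]; have t0 := lt_trans c0 ct.
      by have ? := dF _ t0; exact: ex_derive.
    + by apply: cvg_at_right_filter; apply: is_derive_continuous_at; exact: dF.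
    + apply: cvg_at_left_filter; apply: is_derive_continuous_at; apply: dF.
      exact: lt_trans cb.
  - move=> t; rewrite in_itv/= => /andP[ct _]; have t0 := lt_trans c0 ct.
    by have ? := dF _ t0; rewrite derive1E; exact: derive_val.
apply: (@le_trans _ _ (\int[mu]_(t in exhaust n) (f t)%:E)%E).
  apply: ge0_le_integral => //=.
  - exact: measurable_itv.
  - by move=> t _; rewrite lee_fin gamma_kernel_ge0.
  - by apply/measurable_EFinP; exact: measurable_gamma_kernel.
  - apply/measurable_EFinP; apply: subspace_continuous_measurable_fun.
      exact: measurable_itv.
    apply: continuous_in_subspaceT => t; rewrite inE => /exhaust_gt0; exact: cf.
  move=> t; rewrite ?inE => /exhaust_gt0 t0.
  rewrite lee_fin /gamma_kernel /f ler_pdivlMr//.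
  have := powR_le_add1 a01 t0; have := expR_ge0 (- t).
  by nra.
have h : n.+1%:R^-1 <= n.+1%:R :> R.
  by rewrite (@le_trans _ _ 1)// ?ler1n// invf_le1// ler1n.
have h0 : 0 < n.+1%:R^-1 :> R by rewrite invr_gt0.
have h1 : n.+1%:R^-1 <= 1 :> R by rewrite invf_le1// ler1n.
apply: le_trans (FTC _ _ h0 h) _; rewrite lee_fin.
have := h; have := h0; have := h1; clear h h0 h1.
set c : R := n.+1%:R^-1; set b : R := n.+1%:R => c1 c0 cb.
rewrite /F -mulrBl; apply: ler_wpM2r; first by rewrite invr_ge0 ltW.
have b0 : 0 < b by lra.
have h1 := powR_le_add1 a01 b0; have h2 := powR_ge0 c a.
have e1 := expR_ge0 (- b); have e2 := expR_ge0 (- c).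
have e3 : expR (- c) <= 1 by rewrite expR_le1; lra.
have q1 : 0 <= (1 + b - b `^ a) * expR (- b) by apply: mulr_ge0 => //; lra.
have q2 : 0 <= c `^ a * expR (- c) by exact: mulr_ge0.
have q3 : 0 <= (1 - c) * expR (- c) by apply: mulr_ge0 => //; lra.
move: q1 q2 q3 e1 e2 e3; move: (expR (- c)) (expR (- b)) (b `^ a) (c `^ a).
by move=> *; lra.
Qed.

(** Substituting x = t^2 turns this integral into twice the Gaussian one. On [exhaust n] the image
    is a subinterval of ]0, +oo[, which suffices for a lower bound. *)
Lemma integral_gamma_half :
  ((Num.sqrt pi)%:E <= \int[mu]_(t in `]0%R, +oo[) (gamma_kernel (1 / 2) t)%:E)%E.
Proof.
have -> : (Num.sqrt pi)%:E = (2%:E * \int[mu]_(t in `]0%R, +oo[) (gauss_fun t)%:E)%E.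
  rewrite integral_itv_obnd_cbnd; last first.
    by apply/measurable_EFinP/measurable_funTS; exact: measurable_gauss_fun.
  by rewrite integral0y_gauss -EFinM mulrCA divff ?mulr1.
rewrite -lee_pdivlMl//.
apply: ge0_integral_oy_le => [|t _|n].
- by apply: measurable_funTS; exact: measurable_gauss_fun.
- exact: gauss_fun_ge0.
rewrite lee_pdivlMl//.
pose F t : R := t ^+ 2.
have dF t : is_derive t 1 F (2 * t) by rewrite /F; derive; ring.
have FE : F^`()%classic = (fun t => 2 * t).
  by apply/funext => t; rewrite derive1E; exact: derive_val.
have cF : continuous F by exact: is_derive_continuous dF.
have cF' : continuous (fun t : R => 2 * t).
  by apply: (@is_derive_continuous _ _ (fun => 2)) => t; derive; ring.
have h : n.+1%:R^-1 <= n.+1%:R :> R.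
  by rewrite (@le_trans _ _ 1)// ?ler1n// invf_le1// ler1n.
have h0 : 0 < n.+1%:R^-1 :> R by rewrite invr_gt0.
have : (\int[mu]_(x in `[F (n.+1%:R^-1)%R, F (n.+1%:R)%R]) (gamma_kernel (1 / 2) x)%:E =
    \int[mu]_(x in exhaust n) (((gamma_kernel (1 / 2) \o F) * F^`()%classic) x)%:E)%E.
  apply: integration_by_substitution_increasing => //.
  - move=> s t; rewrite !in_itv/= => /andP[sn _] /andP[tn _] st.
    have s0 : 0 < s by exact: lt_le_trans sn.
    by rewrite /F -subr_gt0 subr_sqr mulr_gt0//; lra.
  - by rewrite FE => t _; exact: cF'.
  - by rewrite FE; apply: cvgP; apply: cvg_at_right_filter; exact: cF'.
  - by rewrite FE; apply: cvgP; apply: cvg_at_left_filter; exact: cF'.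
  - split => [t _||].
    + exact: ex_derive.
    + by apply: cvg_at_right_filter; exact: cF.
    + by apply: cvg_at_left_filter; exact: cF.
  - apply: continuous_in_subspaceT => t; rewrite inE/= in_itv/= => /andP[ct _].
    have t0 : 0 < t by apply: lt_le_trans ct; rewrite /F exprn_gt0.
    have da := @is_derive1_powR R (1 / 2 - 1) t t0.
    by rewrite /gamma_kernel; apply: is_derive_continuous_at; derive; reflexivity.
move=> sub.
rewrite -ge0_integralZl//=; last 3 first.
- exact: measurable_itv.
- by apply/measurable_EFinP/measurable_funTS; exact: measurable_gauss_fun.
- by move=> t _; rewrite lee_fin gauss_fun_ge0.
rewrite (_ : (\int[mu]_(x in exhaust n) _)%E =
    (\int[mu]_(x in exhaust n)
      (((gamma_kernel (1 / 2) \o F) * F^`()%classic) x)%:E)%E); last first.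
  apply: eq_integral => t; rewrite inE => /exhaust_gt0 t0.
  rewrite -EFinM FE mulrfctE/= /gamma_kernel /gauss_fun /F.
  congr EFin.
  have -> : (t ^+ 2) `^ (1 / 2 - 1) = t^-1.
    rewrite -powR_mulrn ?ltW// -powRrM (_ : _ * _ = -1); first by rewrite powR_inv1// ltW.
    by field.
  by field; rewrite gt_eqF.
rewrite -sub; apply: ge0_subset_integral => //=.
- by apply/measurable_EFinP; exact: measurable_gamma_kernel.
- by move=> t _; rewrite lee_fin gamma_kernel_ge0.
- move=> t/=; rewrite !in_itv/= => /andP[ct _]; rewrite andbT; apply: lt_le_trans ct.
  by rewrite /F exprn_gt0.
Qed.

Lemma GammaE a : Gamma a = \int[mu]_(t in `]0%R, +oo[) gamma_kernel a t.
Proof. by []. Qed.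

Lemma Gamma_ge0 a : 0 <= Gamma a.
Proof. by apply: Rintegral_ge0 => t _; exact: gamma_kernel_ge0. Qed.

Lemma sqrt_pi_le_Gamma_half : Num.sqrt pi <= Gamma (1 / 2 : R).
Proof.
have i12 := @integrable_gamma_kernel (1 / 2) ltac:(lra).
rewrite -lee_fin GammaE /Rintegral fineK ?integral_gamma_half//.
exact: integrable_fin_num.
Qed.

(** AM-GM, since t^(a - 1) t^(-a) is the square of t^(-1/2). The free weight l, optimised after
    integration, gives the Cauchy-Schwarz inequality for Gamma. *)
Lemma gamma_kernel_amgm a t (l : R) : 0 < t -> 0 < l ->
  gamma_kernel (1 / 2) t <= l / 2 * gamma_kernel a t + l^-1 / 2 * gamma_kernel (1 - a) t.
Proof.
move=> t0 l0; rewrite /gamma_kernel !mulrA -mulrDl ler_wpM2r ?expR_ge0//.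
set p := t `^ (a - 1); set q := t `^ (1 - a - 1); set w := t `^ (1 / 2 - 1).
have wpq : w * w = p * q.
  have powD r1 r2 : t `^ r1 * t `^ r2 = t `^ (r1 + r2).
    by rewrite powRD// (gt_eqF t0) implybT.
  by rewrite /w /p /q !powD; congr (_ `^ _); field.
have w0 : 0 < w by rewrite powR_gt0.
have p0 : 0 < p by rewrite powR_gt0.
have q0 : 0 < q by rewrite powR_gt0.
rewrite -(@ler_pXn2r _ 2) ?nnegrE//; [|exact: ltW|]; last first.
  by rewrite addr_ge0// !mulr_ge0// ?invr_ge0 ltW.
rewrite expr2 wpq -subr_ge0.
rewrite (_ : _ - _ = (l / 2 * p - l^-1 / 2 * q) ^+ 2) ?sqr_ge0//.
by field; rewrite gt_eqF.
Qed.

(* Integrating [gamma_kernel_amgm] with l = sqrt pi / Gamma a. *)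
Lemma pi_le_GammaM a : 0 < a < 1 -> pi <= Gamma a * Gamma (1 - a).
Proof.
move=> /andP[a0 a1].
have ia := @integrable_gamma_kernel a ltac:(lra).
have ib := @integrable_gamma_kernel (1 - a) ltac:(lra).
have i12 := @integrable_gamma_kernel (1 / 2) ltac:(lra).
have main (l : R) : 0 < l -> 2 * Num.sqrt pi <= l * Gamma a + l^-1 * Gamma (1 - a).
  move=> l0; have := sqrt_pi_le_Gamma_half.
  suff : Gamma (1 / 2) <= l / 2 * Gamma a + l^-1 / 2 * Gamma (1 - a).
    move: (Gamma (1 / 2)) (Gamma a) (Gamma (1 - a)) (Num.sqrt pi) => g A B p.
    by move=> *; lra.
  rewrite !GammaE -!RintegralZl//.
  have iZ k b : mu.-integrable (`]0, +oo[ : set R) (EFin \o gamma_kernel b) ->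
      mu.-integrable (`]0, +oo[ : set R) (EFin \o (fun t => k * gamma_kernel b t)).
    by move=> h; apply: (integrableZl _ k h).
  rewrite -RintegralD//; [|exact: iZ|exact: iZ].
  apply: le_Rintegral => //.
    exact: (integrableD _ (iZ _ _ ia) (iZ _ _ ib)).
  by move=> t; rewrite /= in_itv/= andbT => t0; exact: gamma_kernel_amgm.
move: main (Gamma_ge0 a) (Gamma_ge0 (1 - a)).
move: (Gamma a) (Gamma (1 - a)) => A B main A0 B0.
have pi0 := @pi_gt0 R.
have s0 : 0 < Num.sqrt pi :> R by rewrite sqrtr_gt0.
have s2 : Num.sqrt pi ^+ 2 = pi :> R by rewrite sqr_sqrtr// ltW.
have s1 : 1 <= Num.sqrt pi :> R.
  by rewrite -(@ler_pXn2r _ 2) ?nnegrE// ?s2 ?expr1n ?ltW//; have := @pi_ge2 R; lra.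
(* If A = 0, then [main] at l = B + 1 gives 2 sqrt pi <= B / (B + 1) <= 1, which is absurd. *)
have {}A0 : 0 < A.
  rewrite lt_neqAle A0 andbT; apply/eqP => A00.
  have B1 : 0 < B + 1 by lra.
  have := main _ B1; rewrite -A00 mulr0 add0r.
  have : (B + 1)^-1 * B <= 1 by rewrite mulrC ler_pdivrMr//; lra.
  lra.
have := main (Num.sqrt pi / A) (divr_gt0 s0 A0).
rewrite divfK ?gt_eqF// invf_div => h.
have {}h : Num.sqrt pi <= A / Num.sqrt pi * B by lra.
have := ler_wpM2l (ltW s0) h; rewrite -expr2 s2.
by rewrite (_ : _ * (_ * _) = A * B)//; field; rewrite gt_eqF.
Qed.

End gamma.

(** * The Gaussian bound for order 1/2 *)

Section half_order.
Context {R : realType}.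
Notation mu := (@lebesgue_measure R).
Implicit Types (x y t : R).

Lemma ge0_integral_itvcy_le (f : R -> R) (M : \bar R) :
  (forall x, 0 <= f x) -> continuous f ->
  (forall n : nat, (\int[mu]_(x in `[0%R, n%:R]) (f x)%:E <= M)%E) ->
  (\int[mu]_(x in `[0%R, +oo[) (f x)%:E <= M)%E.
Proof.
move=> f0 cf fM.
have mf : measurable_fun [set: R] f by exact: continuous_measurable_fun.
have h := @ge0_cvgn_integral R mu f f0 mf.
rewrite -(cvg_lim _ h)//; apply: lime_le; first exact: cvgP h.
by apply: nearW => n; exact: fM.
Qed.

(** The integrand of K_{1/2}(y) = sqrt (pi / (2 y)) exp(-y). *)
Definition half_kernel y t := expR (- (y * cosh t)) * cosh (t / 2).

Lemma half_kernel_ge0 y t : 0 <= half_kernel y t.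
Proof. by rewrite mulr_ge0 ?expR_ge0 ?cosh_ge0. Qed.

Lemma continuous_half_kernel y : continuous (half_kernel y).
Proof.
rewrite /half_kernel; apply: (@is_derive_continuous _ _ (fun t =>
  expR (- (y * cosh t)) * (- (y * sinh t)) * cosh (t / 2) +
  expR (- (y * cosh t)) * (sinh (t / 2) / 2))) => t.
by derive; ring.
Qed.

(* Substitution u = sqrt (2 y) * sinh (t / 2) in the Gaussian integral. *)
Lemma integral_half_kernel y : 0 < y ->
  (\int[mu]_(t in `[0%R, +oo[) (half_kernel y t)%:E <= (Num.sqrt (pi / (2 * y)))%:E)%E.
Proof.
move=> y0; apply: ge0_integral_itvcy_le.
- exact: half_kernel_ge0.
- exact: continuous_half_kernel.
move=> n.
pose c : R := Num.sqrt (2 * y).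
have c0 : 0 < c by rewrite sqrtr_gt0 mulr_gt0.
have c2 : c ^+ 2 = 2 * y by rewrite sqr_sqrtr// mulr_ge0// ltW.
pose F t := c * sinh (t / 2).
pose F' t := c * (cosh (t / 2) / 2).
have dF t : is_derive t 1 F (F' t) by rewrite /F /F'; derive; ring.
have FE : F^`()%classic = F' by apply/funext => t; rewrite derive1E; exact: derive_val.
have cF : continuous F by exact: is_derive_continuous dF.
have cF' : continuous F'.
  rewrite /F'.
  apply: (@is_derive_continuous _ _ (fun t => c * (sinh (t / 2) / 2 / 2))) => t.
  by derive; ring.
have F0 : F 0 = 0 by rewrite /F mul0r /sinh oppr0 subrr mul0r mulr0.
have : (\int[mu]_(x in `[F 0%R, F n%:R]) (gauss_fun x)%:E =
    \int[mu]_(x in `[0%R, n%:R]) (((gauss_fun \o F) * F^`()%classic) x)%:E)%E.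
  apply: integration_by_substitution_increasing => //.
  - move=> s t _ _ st; rewrite /F ltr_pM2l// ltr_sinh// ltr_pM2r//.
  - by rewrite FE => t _; exact: cF'.
  - by rewrite FE; apply: cvgP; apply: cvg_at_right_filter; exact: cF'.
  - by rewrite FE; apply: cvgP; apply: cvg_at_left_filter; exact: cF'.
  - split => [t _||].
    + exact: ex_derive.
    + by apply: cvg_at_right_filter; exact: cF.
    + by apply: cvg_at_left_filter; exact: cF.
  - by apply: continuous_subspaceT; exact: continuous_gauss_fun.
rewrite F0 => sub.
have gle : (\int[mu]_(x in `[0%R, F n%:R]) (gauss_fun x)%:E <= (Num.sqrt pi / 2)%:E)%E.
  rewrite -integral0y_gauss; apply: ge0_subset_integral => //=.
  - by apply/measurable_EFinP/measurable_funTS; exact: measurable_gauss_fun.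
  - by move=> x _; rewrite lee_fin gauss_fun_ge0.
  - by move=> x/=; rewrite !in_itv/= => /andP[-> _].
have mG : measurable_fun [set: R] ((gauss_fun \o F) * F^`()%classic).
  rewrite FE; apply: continuous_measurable_fun.
  move=> t; apply: continuousM; last exact: cF'.
  by apply: continuous_comp; [exact: cF|exact: continuous_gauss_fun].
have G0 t : 0 <= ((gauss_fun \o F) * F^`()%classic) t.
  rewrite FE mulrfctE; apply: mulr_ge0; first exact: gauss_fun_ge0.
  by apply: mulr_ge0; [exact: ltW|rewrite divr_ge0// cosh_ge0].
apply: (@le_trans _ _ (\int[mu]_(x in `[0%R, n%:R])
    ((2 / c)%:E * (((gauss_fun \o F) * F^`()%classic) x)%:E))%E).
  apply: ge0_le_integral => //=.
  - by move=> t _; rewrite lee_fin half_kernel_ge0.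
  - apply/measurable_EFinP/measurable_funTS.
    by apply: continuous_measurable_fun; exact: continuous_half_kernel.
  - by apply: emeasurable_funM => //; exact/measurable_EFinP/measurable_funTS.
  move=> t _; rewrite -EFinM lee_fin FE mulrfctE /F' /half_kernel /gauss_fun /=.
  rewrite (_ : 2 / c * _ = expR (- F t ^+ 2) * cosh (t / 2)); last first.
    by field; rewrite gt_eqF.
  (* By [cosh_half], y cosh t = y + (F t)^2; the factor exp(-y) is given up here. *)
  rewrite ler_wpM2r ?cosh_ge0//.
  rewrite ler_expR lerN2 /F exprMn c2 cosh_half.
  by have := sqr_ge0 (sinh (t / 2)); nra.
rewrite ge0_integralZl//; last 3 first.
- by apply/measurable_EFinP/measurable_funTS.
- by move=> t _; rewrite lee_fin G0.
- by rewrite lee_fin divr_ge0// ltW.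
rewrite -sub (le_trans (lee_wpmul2l _ gle))//.
  by rewrite lee_fin divr_ge0// ltW.
have y2 : 0 <= 2 * y by rewrite mulr_ge0// ltW.
rewrite -EFinM lee_fin sqrtrM ?pi_ge0// sqrtrV// -/c.
rewrite (_ : 2 / c * _ = Num.sqrt pi / c)//.
by field; rewrite gt_eqF.
Qed.

End half_order.

(** * Integrals of functions dominated by M exp(-t) *)

Section exponential_decay.
Context {R : realType}.
Notation mu := (@lebesgue_measure R).
Notation Rge0 := (`[0%R, +oo[%classic : set R).
Implicit Types (t k M : R) (f F : R -> R).

(** From exp(u) >= u^3 / 3! at u = k exp(t); the cube pays for exp(2 t) and leaves exp(-t). *)
Lemma expR_exp_decay k t : 0 < k ->
  expR (2 * t - k * expR t) <= 6 / k ^+ 3 * expR (- t).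
Proof.
move=> k0; have e0 := expR_gt0 t.
have h : (k * expR t) ^+ 3 / 6 <= expR (k * expR t).
  have := @expR_ge1Dxn _ (k * expR t) 2 (mulr_ge0 (ltW k0) (ltW e0)).
  by rewrite [in X in X -> _](_ : 3`!%:R = 6)//; lra.
rewrite expRB mulrC ler_pdivrMl ?expR_gt0//.
apply: (@le_trans _ _ ((k * expR t) ^+ 3 / 6 * (6 / k ^+ 3 * expR (- t)))); last first.
  by rewrite ler_wpM2r// mulr_ge0 ?expR_ge0// divr_ge0// exprn_ge0// ltW.
rewrite expRN (_ : 2 * t = t + t); last by ring.
rewrite expRD le_eqVlt; apply/orP; left; apply/eqP; field.
by rewrite !gt_eqF.
Qed.

Lemma Rintegral_expRN_tail c M :
  \int[mu]_(t in `[c, +oo[) (M * expR (- t)) = M * expR (- c) /\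
  mu.-integrable (`[c, +oo[ : set R) (EFin \o (fun t => M * expR (- t))).
Proof.
have cf : continuous (fun t : R => expR (- t)).
  by apply: (@is_derive_continuous _ _ (fun t => - expR (- t))) => t; derive; ring.
have E : (\int[mu]_(t in `[c, +oo[) (expR (- t))%:E = 0%:E - (- expR (- c))%:E)%E.
  apply: (@ge0_continuous_FTC2y _ (fun t => expR (- t)) (fun t => - expR (- t))).
  - by move=> t _; exact: expR_ge0.
  - exact: continuous_subspaceT.
  - by rewrite -oppr0; apply: cvgN; exact: cvgr_expR.
  - move=> t _; have : is_derive t 1 (fun t => - expR (- t)) (expR (- t)) by derive; ring.
    by move=> ?; exact: ex_derive.
  - by apply: cvgN; apply: cvg_at_right_filter; exact: cf.
  - move=> t _; have : is_derive t 1 (fun t => - expR (- t)) (expR (- t)) by derive; ring.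
    by move=> ?; rewrite derive1E; exact: derive_val.
rewrite -EFinB sub0r opprK in E.
have int1 : mu.-integrable (`[c, +oo[ : set R) (EFin \o (fun t => expR (- t))).
  apply/integrableP; split.
    by apply/measurable_EFinP/measurable_funTS; exact: continuous_measurable_fun.
  under eq_integral do rewrite /= ger0_norm ?expR_ge0//.
  by rewrite E ltry.
split; last by apply: (integrableZl _ M int1).
by rewrite RintegralZl//; congr (_ * _); rewrite /Rintegral E.
Qed.

Lemma integrable_exp_decay f M : continuous f ->
  (forall t, 0 <= t -> `|f t| <= M * expR (- t)) ->
  mu.-integrable Rge0 (EFin \o f).
Proof.
move=> cf fM; have [_ iM] := Rintegral_expRN_tail 0 M.
apply: le_integrable iM => //.
  by apply/measurable_EFinP/measurable_funTS; exact: continuous_measurable_fun.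
move=> t; rewrite /= in_itv/= andbT => t0; rewrite lee_fin.
by rewrite (le_trans (fM _ t0))// ler_norm.
Qed.

(** Cut at c: the integral over [0, c] is F(c), and both F(c) and the tail are at most M exp(-c) in
    absolute value. *)
Lemma Rintegral_derivative_decay f F M : continuous f ->
  (forall t, is_derive t 1 F (f t)) -> F 0 = 0 ->
  (forall t, 0 <= t -> `|F t| <= M * expR (- t)) ->
  (forall t, 0 <= t -> `|f t| <= M * expR (- t)) ->
  \int[mu]_(t in Rge0) f t = 0.
Proof.
move=> cf dF F0 FM fM.
have iF := integrable_exp_decay cf fM.
set I := \int[mu]_(t in _) _.
have M0 : 0 <= M by have := FM _ (lexx 0); rewrite F0 normr0 oppr0 expR0 mulr1.
have cF : continuous F by exact: is_derive_continuous dF.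
have bound c : 0 < c -> `|I| <= 2 * (M * expR (- c)).
  move=> c0.
  have h1 : \int[mu]_(t in `[0, c]) f t = F c.
    rewrite /Rintegral (@continuous_FTC2 _ f F 0 c c0) ?F0 ?sube0//.
    - exact: continuous_subspaceT.
    - split => [t _||].
      + by have ? := dF t; exact: ex_derive.
      + by apply: cvg_at_right_filter; exact: cF.
      + by apply: cvg_at_left_filter; exact: cF.
    - by move=> t _; have ? := dF t; rewrite derive1E; exact: derive_val.
  have sub : (`]c, +oo[ : set R) `<=` Rge0.
    by move=> t; rewrite /= !in_itv/= !andbT => /ltW; exact/le_trans/ltW.
  have := @Rintegral_itvB R f (BLeft 0) (BInfty _ false) c iF.
  rewrite !bnd_simp => /(_ (ltW c0) isT); rewrite h1 -/I => IE.
  have {IE}-> : I = F c + \int[mu]_(t in `]c, +oo[) f t by rewrite -IE; ring.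
  rewrite (le_trans (ler_normD _ _))//.
  suff : `|\int[mu]_(t in `]c, +oo[) f t| <= M * expR (- c).
    by have := FM _ (ltW c0); lra.
  have [<- iM] := Rintegral_expRN_tail c M.
  have sub2 : (`]c, +oo[ : set R) `<=` (`[c, +oo[ : set R).
    by move=> t; rewrite /= !in_itv/= !andbT => /ltW.
  have iM2 : mu.-integrable (`]c, +oo[ : set R) (EFin \o (fun t => M * expR (- t))).
    exact: integrableS iM.
  have if2 : mu.-integrable (`]c, +oo[ : set R) (EFin \o f).
    exact: integrableS iF.
  rewrite -Rintegral_itv_obnd_cbnd//.
  apply: le_trans (le_normr_Rintegral _ if2) _ => //.
  apply: le_Rintegral => //.
    exact: (integrable_norm if2).
  by move=> t /sub; rewrite /= in_itv/= andbT; exact: fM.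
apply/eqP; rewrite -normr_eq0; apply/negPn/negP => I0.
have {}I0 : 0 < `|I| by rewrite lt_neqAle eq_sym I0 normr_ge0.
(* A single c replaces the limit: exp(-c) <= 1 / (1 + c) turns [bound] into (1 + c) |I| <= 2 M,
   whereas c |I| = 2 M + 1. *)
have c0 : 0 < (2 * M + 1) / `|I| by rewrite divr_gt0//; lra.
have := bound _ c0; set c := _ / _ => h.
have ec : (1 + c) * expR (- c) <= 1.
  by rewrite expRN ler_pdivrMr ?expR_gt0// mul1r expR_ge1Dx.
have cI : c * `|I| = 2 * M + 1 by rewrite /c divfK// gt_eqF.
have := ler_wpM2l (addr_ge0 ler01 (ltW c0)) h.
rewrite mulrDl mul1r -/c cI => h2.
have := ler_wpM2l M0 ec; nra.
Qed.

End exponential_decay.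

(** * Independence of the integral from the height of the contour *)

Section contour_shift.
Context {R : realType}.
Notation mu := (@lebesgue_measure R).
Notation Rge0 := (`[0%R, +oo[%classic : set R).
Context (x nu tau p q : R).
Implicit Types (th t c : R).

(* [shift_fun] is p Re f + q Im f and [shift_conj] is p Re (i f) + q Im (i f), for
   f(w) = exp(-x cosh w + (nu + i tau) w) at w = t + i th. By the Cauchy-Riemann
   equations [shift_der] is both d/dth [shift_fun] and d/dt [shift_conj]. *)
Definition shift_re th t := - (x * cosh t * cos th) + nu * t - tau * th.
Definition shift_im th t := - (x * sinh t * sin th) + tau * t + nu * th.

Definition shift_fun th t := expR (shift_re th t) *
  (p * cos (shift_im th t) + q * sin (shift_im th t)).
Definition shift_conj th t := expR (shift_re th t) *
  (q * cos (shift_im th t) - p * sin (shift_im th t)).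
Definition shift_der th t := expR (shift_re th t) *
  ((x * cosh t * sin th - tau) * (p * cos (shift_im th t) + q * sin (shift_im th t))
   + (nu - x * sinh t * cos th) * (q * cos (shift_im th t) - p * sin (shift_im th t))).

Lemma is_derive_shift_fun th t :
  is_derive th 1 (fun u => shift_fun u t) (shift_der th t).
Proof. by rewrite /shift_fun /shift_der /shift_re /shift_im; derive; ring. Qed.

Lemma is_derive_shift_conj th t :
  is_derive t 1 (fun u => shift_conj th u) (shift_der th t).
Proof. by rewrite /shift_conj /shift_der /shift_re /shift_im; derive; ring. Qed.

(** Folding the line onto [0, +oo[, where [macdonald] integrates. Under t -> -t a t-derivative
    changes sign, so [sym_conj] is a difference; it vanishes at 0 and leaves no boundary term
    there. *)
Definition sym_fun th t := (shift_fun th t + shift_fun th (- t)) / 2.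
Definition sym_conj th t := (shift_conj th t - shift_conj th (- t)) / 2.
Definition sym_der th t := (shift_der th t + shift_der th (- t)) / 2.

Lemma is_derive_sym_fun th t :
  is_derive th 1 (fun u => sym_fun u t) (sym_der th t).
Proof.
have d1 := is_derive_shift_fun th t; have d2 := is_derive_shift_fun th (- t).
by rewrite /sym_fun /sym_der; derive; ring.
Qed.

Lemma is_derive_sym_conj th t :
  is_derive t 1 (fun u => sym_conj th u) (sym_der th t).
Proof.
have d1 := is_derive_shift_conj th t.
have d2 := is_derive_comp_opp (is_derive_shift_conj th (- t)).
by rewrite /sym_conj /sym_der; derive; ring.
Qed.

Lemma continuous_sym_fun th : continuous (sym_fun th).
Proof.
move=> t; rewrite /sym_fun /shift_fun /shift_re /shift_im.
by apply: is_derive_continuous_at; derive; reflexivity.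
Qed.

Lemma continuous_sym_der th : continuous (sym_der th).
Proof.
move=> t; rewrite /sym_der /shift_der /shift_re /shift_im.
by apply: is_derive_continuous_at; derive; reflexivity.
Qed.

Lemma sym_conj0 th : sym_conj th 0 = 0.
Proof. by rewrite /sym_conj oppr0 subrr mul0r. Qed.

(** The factors bound, in order, the trigonometric part, exp(-tau th) for |th| <= 2, the
    coefficients in [shift_der] up to exp(t), and the double exponential by [expR_exp_decay] with k
    = x c / 2, where c <= cos th. *)
Definition decay_const c :=
  (`|p| + `|q|) * expR (2 * `|tau|) * (2 * x + `|tau| + 1) * (6 / (x * c / 2) ^+ 3).

Context (hx : 0 < x) (hnu : `|nu| <= 1).

Lemma expR_shift_re_le c th t s : 0 < c -> c <= cos th -> `|th| <= 2 -> 0 <= t ->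
  s = t \/ s = - t ->
  expR (shift_re th s) <= expR (2 * `|tau|) * expR (t - x * c / 2 * expR t).
Proof.
move=> c0 cth th2 t0 st.
have -> : shift_re th s = - (x * cosh t * cos th) + nu * s - tau * th.
  by rewrite /shift_re; case: st => ->; rewrite ?coshN.
rewrite -expRD ler_expR.
have h1 : - (tau * th) <= 2 * `|tau|.
  rewrite (le_trans (ler_norm _))// normrN normrM mulrC ler_wpM2r//.
have h2 : nu * s <= t.
  rewrite (le_trans (ler_norm _))// normrM.
  have -> : `|s| = t by case: st => ->; rewrite ?normrN ger0_norm.
  by rewrite ler_piMl.
have h3 : x * c / 2 * expR t <= x * cosh t * cos th.
  have -> : x * c / 2 * expR t = x * (expR t / 2) * c by ring.
  apply: ler_pM => //.
  - by rewrite mulr_ge0 ?divr_ge0 ?expR_ge0// ltW.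
  - exact: ltW.
  - by rewrite ler_wpM2l ?cosh_ge_expR_half// ltW.
lra.
Qed.

Lemma norm_trig_le (P Q u : R) : `|P * cos u + Q * sin u| <= `|P| + `|Q|.
Proof.
rewrite (le_trans (ler_normD _ _))// !normrM lerD// ler_piMr// ler_norml.
  by rewrite cos_geN1 cos_le1.
by rewrite sin_geN1 sin_le1.
Qed.

(** The bound depends on th only through c, as domination requires. Of the two factors exp(t)
    absorbed, one comes from exp(nu s) and one from cosh and sinh in [shift_der]. *)
Lemma shift_bounds c th t s : 0 < c -> c <= cos th -> `|th| <= 2 -> 0 <= t ->
  s = t \/ s = - t ->
  [/\ `|shift_fun th s| <= decay_const c * expR (- t),
      `|shift_conj th s| <= decay_const c * expR (- t)
    & `|shift_der th s| <= decay_const c * expR (- t)].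
Proof.
move=> c0 cth th2 t0 st.
have eA := expR_shift_re_le c0 cth th2 t0 st.
have k0 : 0 < x * c / 2 by rewrite divr_gt0 ?mulr_gt0.
have dec := expR_exp_decay t k0.
set P : R := `|p| + `|q|.
have P0 : 0 <= P by rewrite addr_ge0.
have e1 : 1 <= expR t by rewrite -expR0 ler_expR.
have b1 := norm_trig_le p q (shift_im th s).
have b2 : `|q * cos (shift_im th s) - p * sin (shift_im th s)| <= P.
  by rewrite -mulNr (le_trans (norm_trig_le _ _ _))// normrN addrC.
have nt := normr_ge0 tau.
have key (z : R) : `|z| <= P * ((2 * x + `|tau| + 1) * expR t) ->
    `|expR (shift_re th s) * z| <= decay_const c * expR (- t).
  move=> hz; rewrite normrM (ger0_norm (expR_ge0 _)).
  apply: le_trans (ler_pM (expR_ge0 _) (normr_ge0 _) eA hz) _.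
  rewrite [leLHS](_ : _ = P * expR (2 * `|tau|) * (2 * x + `|tau| + 1) *
    expR (2 * t - x * c / 2 * expR t)); last first.
    have -> : 2 * t - x * c / 2 * expR t = t + (t - x * c / 2 * expR t) by ring.
    by rewrite [in RHS]expRD; ring.
  rewrite /decay_const -/P -[leRHS]mulrA; apply: ler_wpM2l => //.
  apply: mulr_ge0; first by rewrite mulr_ge0 ?expR_ge0.
  by rewrite !addr_ge0 ?mulr_ge0 ?(ltW hx).
have big : P <= P * ((2 * x + `|tau| + 1) * expR t).
  rewrite ler_peMr//; move: nt hx e1; move: (`|tau|) (expR t) => T e T0 x0 e1; nra.
have coshs : cosh s <= expR t.
  by case: st => ->; rewrite ?coshN cosh_le_expR.
have c_s := cosh_ge0 s.
have sinhs := norm_sinh_le_cosh s.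
split; apply: key.
- exact: le_trans big.
- exact: le_trans big.
have prod_le (a b : R) : `|a| <= expR t -> `|b| <= 1 -> `|x * a * b| <= x * expR t.
  move=> ae b1'; rewrite !normrM (gtr0_norm hx) -[leRHS]mulr1.
  by apply: ler_pM => //; [rewrite mulr_ge0 ?(ltW hx) | rewrite ler_wpM2l ?(ltW hx)].
have s1 : `|sin th| <= 1 by rewrite ler_norml sin_geN1 sin_le1.
have k1 : `|cos th| <= 1 by rewrite ler_norml cos_geN1 cos_le1.
have x1 : `|x * cosh s * sin th| <= x * expR t.
  by apply: prod_le => //; rewrite ger0_norm.
have x2 : `|x * sinh s * cos th| <= x * expR t.
  by apply: prod_le => //; exact: le_trans coshs.
apply: le_trans (ler_normD _ _) _; rewrite 2!normrM.
apply: (@le_trans _ _ ((x * expR t + `|tau|) * P + (1 + x * expR t) * P)).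
  apply: lerD; apply: ler_pM => //.
    by apply: le_trans (ler_normB _ _) _; rewrite lerD.
  by apply: le_trans (ler_normB _ _) _; rewrite lerD.
rewrite -mulrDl mulrC ler_wpM2l//.
move: nt hx e1; move: (`|tau|) (expR t) => T e T0 x0 e1; nra.
Qed.

Lemma sym_bounds c th t : 0 < c -> c <= cos th -> `|th| <= 2 -> 0 <= t ->
  [/\ `|sym_fun th t| <= decay_const c * expR (- t),
      `|sym_conj th t| <= decay_const c * expR (- t)
    & `|sym_der th t| <= decay_const c * expR (- t)].
Proof.
move=> c0 cth th2 t0.
have [f1 g1 d1] := shift_bounds c0 cth th2 t0 (or_introl erefl).
have [f2 g2 d2] := shift_bounds c0 cth th2 t0 (or_intror erefl).
have half (a b M : R) : `|a| <= M -> `|b| <= M -> `|(a + b) / 2| <= M :> R.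
  by move=> *; rewrite normrM (@ger0_norm _ 2^-1)// ler_pdivrMr//
    (le_trans (ler_normD _ _))//; lra.
split; [exact: half | apply: half; rewrite ?normrN | exact: half] => //.
Qed.

Lemma integrable_sym_fun th : 0 < cos th -> `|th| <= 2 ->
  mu.-integrable Rge0 (EFin \o sym_fun th).
Proof.
move=> cth th2; apply: (@integrable_exp_decay _ _ (decay_const (cos th))).
  exact: continuous_sym_fun.
by move=> t t0; have [] := sym_bounds cth (lexx _) th2 t0.
Qed.

Lemma Rintegral_sym_der th : 0 < cos th -> `|th| <= 2 ->
  \int[mu]_(t in Rge0) sym_der th t = 0.
Proof.
move=> cth th2.
have bH t : 0 <= t -> `|sym_conj th t| <= decay_const (cos th) * expR (- t).
  by move=> t0; have [] := sym_bounds cth (lexx _) th2 t0.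
have bD t : 0 <= t -> `|sym_der th t| <= decay_const (cos th) * expR (- t).
  by move=> t0; have [] := sym_bounds cth (lexx _) th2 t0.
exact: (Rintegral_derivative_decay (@continuous_sym_der th) (is_derive_sym_conj th)
  (sym_conj0 th) bH bD).
Qed.

Lemma cos_ge_of_norm_le a th : 0 <= a <= pi -> `|th| <= a -> cos a <= cos th.
Proof.
move=> /andP[a0 api] tha.
have -> : cos th = cos `|th| by case: (ger0P th) => // _; rewrite cosN.
by rewrite leNgt ltr_cos ?in_itv/= ?normr_ge0 ?a0 ?api ?(le_trans tha)// -leNgt.
Qed.

(** Differentiating under the integral sign gives the integral of [sym_der], which is zero. *)
Lemma Rintegral_sym_fun_shift th0 : 0 <= th0 < pi / 2 ->
  \int[mu]_(t in Rge0) sym_fun 0 t <= \int[mu]_(t in Rge0) sym_fun th0 t.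
Proof.
move=> /andP[th00 th0pi].
(* The midpoint of th0 and pi / 2: the open interval ]-a, a[ contains [0, th0] with its endpoints,
   and cos a > 0 bounds cos from below on it, which yields one dominating function. *)
pose a := (th0 + pi / 2) / 2.
have /andP[_ pi_ub] := @pi_bounds R.
have p0 := @pi_gt0 R.
have [a0 api a2] : [/\ 0 < a, a < pi / 2 & a <= 2] by split; rewrite /a; lra.
have c0 : 0 < cos a by rewrite cos_gt0_pihalf//; apply/andP; split; lra.
have cth th : `|th| <= a -> cos a <= cos th.
  by apply: cos_ge_of_norm_le; apply/andP; split; lra.
have in_norm th : (`](- a), a[%classic : set R) th -> `|th| <= a.
  by rewrite /= in_itv/= => /andP[h1 h2]; rewrite ler_norml !ltW.
pose I th := \int[mu]_(t in Rge0) sym_fun th t.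
suff dI th : 0 <= th <= th0 -> is_derive th 1 I 0.
  exact: (@le_of_derive _ I (fun=> 0) 0 th0 th00).
move=> /andP[th0' thth0].
have Ith : (`](- a), a[%classic : set R) th.
  by rewrite /= in_itv/=; apply/andP; split; rewrite /a; lra.
have tha := in_norm _ Ith.
pose M := decay_const (cos a).
have [_ iM] := Rintegral_expRN_tail (0 : R) M.
have M0 t : 0 <= M * expR (- t).
  have [h _ _] := sym_bounds c0 (cth _ tha) (le_trans tha a2) (lexx 0).
  have : 0 <= M by have := le_trans (normr_ge0 _) h; rewrite oppr0 expR0 mulr1.
  by move=> ?; rewrite mulr_ge0 ?expR_ge0.
have intf u : (`](- a), a[%classic : set R) u -> mu.-integrable Rge0 (EFin \o sym_fun u).
  move=> /in_norm ua; apply: integrable_sym_fun; last exact: le_trans a2.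
  exact: lt_le_trans (cth _ ua).
have derf u t : (`](- a), a[%classic : set R) u -> Rge0 t -> derivable (sym_fun ^~ t) u 1.
  by move=> _ _; have ? := is_derive_sym_fun u t; exact: ex_derive.
have d1E u t : partial1of2 sym_fun u t = sym_der u t.
  by rewrite partial1of2E; have ? := is_derive_sym_fun u t; exact: derive_val.
have ub u t : (`](- a), a[%classic : set R) u -> Rge0 t ->
    `|partial1of2 sym_fun u t| <= M * expR (- t).
  move=> /in_norm ua; rewrite /= in_itv/= andbT => t0; rewrite d1E.
  by have [] := sym_bounds c0 (cth _ ua) (le_trans ua a2) t0.
have mD : measurable Rge0 by exact: measurable_itv.
have D := @derivable_under_integral R _ _ mu sym_fun Rge0 mD th (- a) a Ith intf derf
  (fun t => M * expR (- t)) M0 iM ub.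
have E := @differentiation_under_integral R _ _ mu sym_fun Rge0 mD th (- a) a
  Ith intf derf (fun t => M * expR (- t)) M0 iM ub.
apply: DeriveDef; first exact: D.
rewrite -derive1E E.
transitivity (\int[mu]_(t in Rge0) sym_der th t).
  by apply: eq_Rintegral => t _; exact: d1E.
apply: Rintegral_sym_der; last exact: le_trans a2.
exact: lt_le_trans (cth _ tha).
Qed.

End contour_shift.

(** * Bounding the shifted integral and assembling the estimate *)

Section assembly.
Context {R : realType}.
Notation mu := (@lebesgue_measure R).
Notation Rge0 := (`[0%R, +oo[%classic : set R).
Implicit Types (x nu tau p q th t : R).

Lemma Rintegral_half_kernel (y : R) : 0 < y ->
  mu.-integrable Rge0 (EFin \o half_kernel y) /\
  \int[mu]_(t in Rge0) half_kernel y t <= Num.sqrt (pi / (2 * y)).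
Proof.
move=> y0; have h := integral_half_kernel y0.
have i : mu.-integrable Rge0 (EFin \o half_kernel y).
  apply/integrableP; split.
    apply/measurable_EFinP/measurable_funTS; apply: continuous_measurable_fun.
    exact: continuous_half_kernel.
  under eq_integral do rewrite /= ger0_norm ?half_kernel_ge0//.
  by apply: le_lt_trans h _; rewrite ltry.
split => //; rewrite -lee_fin /Rintegral fineK//.
exact: integrable_fin_num.
Qed.

Lemma trig_le_sqrt p q (u : R) : p * cos u + q * sin u <= Num.sqrt (p ^+ 2 + q ^+ 2).
Proof.
rewrite (le_trans (ler_norm _))// -sqrtr_sqr ler_sqrt ?addr_ge0 ?sqr_ge0//.
have := cos2Dsin2 u; have := sqr_ge0 (p * sin u - q * cos u).
move: (cos u) (sin u) => c s h e.
rewrite -subr_ge0 (_ : _ - _ = (p * s - q * c) ^+ 2 +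
  (p ^+ 2 + q ^+ 2) * (1 - (c ^+ 2 + s ^+ 2))); last by ring.
by rewrite e subrr mulr0 addr0.
Qed.

(** With u = exp(t / 2) and v = exp(nu t), u + 1/u - v - 1/v = (u - v) (1 - 1/(u v)), and both
    factors are nonnegative. *)
Lemma cosh_scale_le nu t : `|nu| <= 1 / 2 -> 0 <= t -> cosh (nu * t) <= cosh (t / 2).
Proof.
move=> nu12 t0; have /andP[n1 n2] : - (1 / 2) <= nu <= 1 / 2 by rewrite -ler_norml.
have a : 0 <= expR (t / 2) - expR (nu * t) by rewrite subr_ge0 ler_expR; nra.
have b : 0 <= 1 - expR (- (t / 2)) * expR (- (nu * t)).
  by rewrite -expRD subr_ge0 expR_le1; nra.
have := mulr_ge0 a b; rewrite /cosh.
have := expRxMexpNx_1 (t / 2); have := expRxMexpNx_1 (nu * t).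
move: (expR (t / 2)) (expR (- (t / 2))) (expR (nu * t)) (expR (- (nu * t))).
move=> e f g h gh ef.
rewrite (_ : (e - g) * (1 - f * h) = e - e * f * h - g + g * h * f); last by ring.
by rewrite gh ef; lra.
Qed.

Lemma sym_fun_le x nu tau p q th t : `|nu| <= 1 / 2 -> 0 <= t ->
  sym_fun x nu tau p q th t <=
  Num.sqrt (p ^+ 2 + q ^+ 2) * expR (- (tau * th)) * half_kernel (x * cos th) t.
Proof.
move=> nu12 t0; set r := Num.sqrt _.
have r0 : 0 <= r by exact: sqrtr_ge0.
have le s : shift_fun x nu tau p q th s <= expR (shift_re x nu tau th s) * r.
  by rewrite ler_wpM2l ?expR_ge0 ?trig_le_sqrt.
apply: (@le_trans _ _ (r * (expR (- (tau * th)) *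
    (expR (- (x * cos th * cosh t)) * cosh (nu * t))))).
  have -> : r * (expR (- (tau * th)) * (expR (- (x * cos th * cosh t)) * cosh (nu * t))) =
     (expR (shift_re x nu tau th t) * r + expR (shift_re x nu tau th (- t)) * r) / 2.
    rewrite /shift_re coshN !expRD mulrN [x * cosh t * _]mulrAC [cosh (nu * t)]/cosh.
    by ring.
  by rewrite /sym_fun ler_pM2r ?invr_gt0// lerD.
rewrite /half_kernel -!mulrA ler_wpM2l// ler_wpM2l ?expR_ge0// ler_wpM2l ?expR_ge0//.
exact: cosh_scale_le.
Qed.

Lemma sym_fun_linear x nu tau p q th t : sym_fun x nu tau p q th t =
  p * sym_fun x nu tau 1 0 th t + q * sym_fun x nu tau 0 1 th t.
Proof. by rewrite /sym_fun /shift_fun; ring. Qed.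

Lemma macdonald_integrandE x nu tau t :
  (expR (- x * cosh t))%:C * coshC ((nu +i* tau) * t%:C) =
  sym_fun x nu tau 1 0 0 t +i* sym_fun x nu tau 0 1 0 t.
Proof.
have half : (2 : R[i])^-1 = (2^-1 : R) +i* 0.
  by rewrite -(rmorph_nat (real_complex R) 2) -fmorphV.
rewrite /coshC half.
rewrite /sym_fun /shift_fun /shift_re /shift_im /expC coshN cos0 sin0.
simpc => /=.
by rewrite !expRD; congr (_ +i* _); ring.
Qed.

(* The weights p, q are the real and imaginary parts of the integral itself, so
   that the real integral of [sym_fun] is its squared modulus. *)
Lemma norm_macdonald_le x nu tau th : 0 < x -> `|nu| <= 1 / 2 -> 0 <= th < pi / 2 ->
  `|macdonald (nu +i* tau) x| <=
  (expR (- (tau * th)) * Num.sqrt (pi / (2 * (x * cos th))))%:C.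
Proof.
move=> x0 nu12 th_itv; have /andP[th0 thpi] := th_itv.
have nu1 : `|nu| <= 1 by lra.
have cth : 0 < cos th by rewrite cos_gt0_pihalf// thpi andbT; have := @pi_gt0 R; lra.
have y0 : 0 < x * cos th by rewrite mulr_gt0.
have /andP[_ pi_ub] := @pi_bounds R.
have th2 : `|th| <= 2 by rewrite ger0_norm//; lra.
set M := expR _ * _.
have M0 : 0 <= M by rewrite mulr_ge0 ?expR_ge0 ?sqrtr_ge0.
have int0 p q : mu.-integrable Rge0 (EFin \o sym_fun x nu tau p q 0).
  by apply: integrable_sym_fun => //; rewrite ?cos0 ?normr0.
pose a := \int[mu]_(t in Rge0) sym_fun x nu tau 1 0 0 t.
pose b := \int[mu]_(t in Rge0) sym_fun x nu tau 0 1 0 t.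
have -> : macdonald (nu +i* tau) x = a +i* b.
  rewrite /macdonald /Cintegral /a /b.
  by congr (_ +i* _); apply: eq_Rintegral => t _; rewrite macdonald_integrandE.
rewrite normc_def /= lecR.
set r := Num.sqrt _.
have r2 : r ^+ 2 = a ^+ 2 + b ^+ 2 by rewrite sqr_sqrtr// addr_ge0 ?sqr_ge0.
have r_ge0 : 0 <= r by exact: sqrtr_ge0.
(* For p = a and q = b the factor sqrt (p^2 + q^2) of [sym_fun_le] is r itself, so one r cancels at
   the end. *)
have : r ^+ 2 <= r * M.
  have -> : r ^+ 2 = \int[mu]_(t in Rge0) sym_fun x nu tau a b 0 t.
    have iZ k p q : mu.-integrable Rge0 (EFin \o (fun t => k * sym_fun x nu tau p q 0 t)).
      by apply: (integrableZl _ k (int0 p q)).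
    under eq_Rintegral do rewrite sym_fun_linear.
    by rewrite RintegralD// !RintegralZl// r2 !expr2.
  apply: le_trans (Rintegral_sym_fun_shift tau a b x0 nu1 th_itv) _.
  have [ik kle] := Rintegral_half_kernel y0.
  apply: (@le_trans _ _ (\int[mu]_(t in Rge0)
      (r * expR (- (tau * th)) * half_kernel (x * cos th) t))).
    apply: le_Rintegral => //.
    - exact: integrable_sym_fun.
    - by apply: (integrableZl _ _ ik).
    - by move=> t; rewrite /= in_itv/= andbT => t0; exact: sym_fun_le.
  by rewrite RintegralZl// /M [leRHS]mulrA ler_wpM2l// mulr_ge0 ?expR_ge0.
have [->//|rn0] := eqVneq r 0.
have {}r_ge0 : 0 < r by rewrite lt_neqAle eq_sym rn0.
by rewrite expr2 ler_pM2l.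
Qed.

Lemma expR_shift_gain (s : R) :
  expR (shift_gain s) = Num.sqrt (1 + s ^+ 2) * expR (- (s * atan s)).
Proof.
have s1 : 0 < 1 + s ^+ 2 by rewrite ltr_wpDr// sqr_ge0.
rewrite /shift_gain expRD; congr (_ * _).
have e0 := expR_ge0 (ln (1 + s ^+ 2) / 2).
rewrite -[LHS](ger0_norm e0) -sqrtr_sqr -expRM_natl; congr Num.sqrt.
by rewrite mulrC divfK ?lnK ?posrE.
Qed.

(** After squaring and dividing by pi / (2 x) this is [shift_gain_le] at s = 2 tau, because cos
    (atan s) = 1 / sqrt (1 + s^2). *)
Lemma shift_bound_le x tau : 0 < x -> 0 < tau ->
  expR (- (tau * atan (2 * tau))) *
    Num.sqrt (pi / (2 * (x * cos (atan (2 * tau))))) <=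
  pi * Num.sqrt (tau / (2 * x * sinh (pi * tau))).
Proof.
move=> x0 tau0; have p0 := @pi_gt0 R; set s := 2 * tau.
have s0 : 0 < s by rewrite mulr_gt0.
have w0 : 0 < Num.sqrt (1 + s ^+ 2) by rewrite sqrtr_gt0 ltr_wpDr// sqr_ge0.
have sh0 : 0 < sinh (pi * tau).
  by rewrite /sinh divr_gt0// subr_gt0 ltr_expR; have := mulr_gt0 p0 tau0; lra.
have den0 : 0 < 2 * x * sinh (pi * tau) by apply: mulr_gt0 => //; exact: mulr_gt0.
have e0 := expR_ge0 (- (tau * atan s)).
rewrite -[X in X * _ <= _](ger0_norm e0) -[X in _ <= X * _](ger0_norm (ltW p0)).
rewrite -!sqrtr_sqr -!sqrtrM ?sqr_ge0// ler_sqrt; last first.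
  by apply: mulr_ge0; [exact: sqr_ge0 | apply: divr_ge0; apply: ltW => //].
have := shift_gain_le (ltW s0).
rewrite expR_shift_gain (_ : pi / 2 * s = pi * tau); last by rewrite /s; field.
have -> : expR (- (s * atan s)) = expR (- (tau * atan s)) ^+ 2.
  by rewrite -expRM_natl; congr expR; rewrite /s; ring.
rewrite cos_atan -/s => h.
set e := expR _ in h *; set w := Num.sqrt _ in h w0 *.
rewrite (_ : e ^+ 2 * _ = pi / (2 * x) * (w * e ^+ 2)); last first.
  by field; rewrite !gt_eqF.
rewrite (_ : pi ^+ 2 * _ = pi / (2 * x) * (pi * tau / sinh (pi * tau))); last first.
  by field; rewrite !gt_eqF.
apply: ler_wpM2l; last by rewrite ler_pdivlMr.
by rewrite divr_ge0 ?mulr_ge0 ?(ltW p0) ?(ltW x0).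
Qed.

End assembly.

(* The inequality is between real elements of R[i], where `| z | is the modulus
   of z as an element of R[i]. *)
Theorem mainTheorem7 (R : realType) (nu : R)
    (hnu1 : - (1 / 2) <= nu) (hnu2 : nu < 1 / 2)
    (x tau : R) (hx : 0 < x) (htau : 0 < tau) :
  `| macdonald (nu +i* tau) x | <=
  (Gamma ((nu + 3 / 2) / 2) * Gamma ((1 / 2 - nu) / 2)
   * Num.sqrt (tau / (2 * x * sinh (pi * tau))))%:C.
Proof.
have nu12 : `|nu| <= 1 / 2 by rewrite ler_norml hnu1 ltW.
have th_itv : 0 <= atan (2 * tau) < pi / 2.
  by rewrite atan_ltpi2 andbT -[leLHS]atan0 le_atan// mulr_ge0// ltW.
apply: le_trans (norm_macdonald_le tau hx nu12 th_itv) _; rewrite lecR.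
apply: le_trans (shift_bound_le hx htau) _; apply: ler_wpM2r; first exact: sqrtr_ge0.
(* The range of nu places a = (1/2 - nu) / 2 in ]0, 1/2]. *)
rewrite mulrC (_ : (nu + 3 / 2) / 2 = 1 - (1 / 2 - nu) / 2); last by field.
by apply: pi_le_GammaM; apply/andP; split; lra.
Qed.
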